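(* Let $\mathcal A$ be a unital $C^*$-algebra with identity $1$ and let $\alpha:\mathcal A\to\mathcal A$ be an endomorphism. A complete transfer operator for $(\mathcal A,\alpha)$, i.e. a transfer operator $\mathcal L$ for $(\mathcal A,\alpha)$ such that $\alpha(\mathcal L(a))=\alpha(1)a\alpha(1)$ for all $a\in\mathcal A$, exists if and only if $\ker\alpha$ is unital and the range $\alpha(\mathcal A)$ is a hereditary subalgebra of $\mathcal A$.
   Context: An endomorphism is a $*$-homomorphism $\alpha:\mathcal A\to\mathcal A$, not assumed to be unital or injective. The kernel $\ker\alpha$ is called unital if it possesses a multiplicative unit as an algebra (the zero ideal counts as unital, with unit $0$). A transfer operator for $(\mathcal A,\alpha)$ is a continuous positive linear map $\mathcal L:\mathcal A\to\mathcal A$ with $\mathcal L(\alpha(a)b)=a\mathcal L(b)$ for all $a,b\in\mathcal A$. *)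

(* Defs.v *)
From HB Require Import structures.
From mathcomp Require Import all_boot all_order all_algebra.
From mathcomp Require Import all_classical all_reals all_analysis.
From mathcomp Require Import complex.

Set Implicit Arguments.
Unset Strict Implicit.
Unset Printing Implicit Defensive.

Import Order.TTheory GRing.Theory Num.Theory.
Import numFieldNormedType.Exports.

Local Open Scope classical_set_scope.
Local Open Scope ring_scope.

(* The hierarchy has no join of ring and normed-module structures, so the
   product is part of the mixin and the ring structure is derived from it
   below. Taking a [pzRingType] admits the zero algebra, which [GRing.Algebra]
   (an extension of [nzRingType]) would exclude. Norms take their values in
   the nonnegative reals of [R[i]]. *)
HB.mixin Record CompleteNormedModule_isUnitalCStarAlgebra
    (R : realType) A of CompleteNormedModule R[i] A := {
  cstar_one : A ;
  cstar_mul : A -> A -> A ;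
  star : A -> A ;
  cstar_mulA : associative cstar_mul ;
  cstar_mul1l : left_id cstar_one cstar_mul ;
  cstar_mul1r : right_id cstar_one cstar_mul ;
  cstar_mulDl : left_distributive cstar_mul +%R ;
  cstar_mulDr : right_distributive cstar_mul +%R ;
  cstar_scalerAl : forall (c : R[i]) (x y : A),
    c *: cstar_mul x y = cstar_mul (c *: x) y ;
  cstar_scalerAr : forall (c : R[i]) (x y : A),
    c *: cstar_mul x y = cstar_mul x (c *: y) ;
  cstar_normM : forall x y : A, `|cstar_mul x y| <= `|x| * `|y| ;
  starK : involutive star ;
  starD : forall x y : A, star (x + y) = star x + star y ;
  starZ : forall (c : R[i]) (x : A), star (c *: x) = c^* *: star x ;
  starM : forall x y : A, star (cstar_mul x y) = cstar_mul (star y) (star x) ;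
  cstar_norm : forall x : A, `|cstar_mul (star x) x| = `|x| ^+ 2
}.

#[short(type="unitalCStarAlgType")]
HB.structure Definition UnitalCStarAlgebra (R : realType) :=
  { A of CompleteNormedModule R[i] A
       & CompleteNormedModule_isUnitalCStarAlgebra R A }.

HB.instance Definition _ (R : realType) (A : unitalCStarAlgType R) :=
  GRing.Zmodule_isPzRing.Build A
    cstar_mulA cstar_mul1l cstar_mul1r cstar_mulDl cstar_mulDr.

Section CStarAlgebra.
Context {R : realType} {A : unitalCStarAlgType R}.

Definition positive_elt (a : A) : Prop := exists b : A, a = star b * b.

Definition elt_le (a b : A) : Prop := positive_elt (b - a).

(* The multiplicative unit of [B] need not be the identity of [A]. *)
Definition has_mul_unit (B : set A) : Prop :=
  exists2 e : A, B e & forall a : A, B a -> e * a = a /\ a * e = a.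

Record cstar_subalgebra (B : set A) : Prop := CStarSubalgebra {
  cstar_sub0 : B 0 ;
  cstar_subD : forall x y : A, B x -> B y -> B (x + y) ;
  cstar_subZ : forall (c : R[i]) (x : A), B x -> B (c *: x) ;
  cstar_subM : forall x y : A, B x -> B y -> B (x * y) ;
  cstar_sub_star : forall x : A, B x -> B (star x) ;
  cstar_sub_closed : closed B
}.

Record hereditary_subalgebra (B : set A) : Prop := HereditarySubalgebra {
  hereditary_cstar_sub : cstar_subalgebra B ;
  hereditary_le : forall a b : A,
    positive_elt a -> positive_elt b -> B b -> elt_le a b -> B a
}.

(* A *-homomorphism A -> A; linearity is carried by the type of [alpha], and
   neither [alpha 1 = 1] nor injectivity is required. *)
Record star_endomorphism (alpha : {linear A -> A}) : Prop := StarEndomorphism {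
  star_endoM : forall x y : A, alpha (x * y) = alpha x * alpha y ;
  star_endo_star : forall x : A, alpha (star x) = star (alpha x)
}.

Definition ker_endo (alpha : {linear A -> A}) : set A :=
  [set a | alpha a = 0].

Record transfer_operator (alpha L : {linear A -> A}) : Prop :=
  TransferOperator {
  transfer_continuous : continuous L ;
  transfer_positive : forall a : A, positive_elt a -> positive_elt (L a) ;
  transfer_identity : forall a b : A, L (alpha a * b) = a * L b
}.

Record complete_transfer_operator (alpha L : {linear A -> A}) : Prop :=
  CompleteTransferOperator {
  complete_transfer : transfer_operator alpha L ;
  complete_identity : forall a : A, alpha (L a) = alpha 1 * a * alpha 1
}.

End CStarAlgebra.

(* Main.v *)
(* If [L] is a complete transfer operator, then [L 1] is a central projection,
   [1 - L 1] is a unit of the kernel, and the range of [alpha] is the corner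
   [p A p] with [p = alpha 1], which is hereditary because a sum of two
   positive elements vanishes only if both do. Conversely, if the kernel has
   the unit [e], then [e] is a central projection, and the range, being
   hereditary, is the whole corner [p A p]; one takes for [L x] the inverse
   image of [p x p] in [(1 - e) A]. It is contractive because a self-adjoint
   contraction is the real part of a unitary, and positive because positive
   elements have square roots.

   That [-x* x = y* y] forces [x = 0] is obtained from the norm alone, without
   spectral theory: spectral positivity of [a] is expressed as
   [|t 1 - a| <= t] for some [t >= 0], and functional calculus is reduced to
   square roots. *)

Require Import Defs.
From HB Require Import structures.
From mathcomp Require Import all_boot all_order all_algebra.
From mathcomp Require Import all_classical all_reals all_analysis.
From mathcomp Require Import complex.
From mathcomp Require Import ring lra.

Set Implicit Arguments.
Unset Strict Implicit.

Import Order.TTheory GRing.Theory Num.Theory.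
Import numFieldNormedType.Exports.

Local Open Scope classical_set_scope.
Local Open Scope ring_scope.
Local Open Scope complex_scope.

Section CStarTheory.
Context {R : realType} {A : unitalCStarAlgType R}.
Implicit Types (a b x y : A) (r t : R) (c : R[i]).

(** * The involution and the real-valued norm *)

Lemma cscalerAl c x y : c *: (x * y) = (c *: x) * y.
Proof. exact: cstar_scalerAl. Qed.

Lemma cscalerAr c x y : c *: (x * y) = x * (c *: y).
Proof. exact: cstar_scalerAr. Qed.

Lemma star_mul x y : star (x * y) = star y * star x.
Proof. exact: starM. Qed.

Lemma star0 : star (0 : A) = 0.
Proof. by apply: (addrI (star 0)); rewrite -starD !addr0. Qed.

Lemma starN x : star (- x) = - star x.
Proof. by apply/eqP; rewrite -addr_eq0 -starD addNr star0. Qed.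

Lemma starB x y : star (x - y) = star x - star y.
Proof. by rewrite starD starN. Qed.

Lemma star1 : star (1 : A) = 1.
Proof. by have := star_mul (star 1) 1; rewrite mulr1 starK mulr1. Qed.

Lemma starZr r x : star (r%:C *: x) = r%:C *: star x.
Proof. by rewrite starZ conj_Creal // complex_real. Qed.

Lemma starZi x : star ('i *: x) = - ('i *: star x).
Proof. by rewrite starZ conjCi scaleNr. Qed.

(** The norm of [A] takes values in [R[i]]; its real part brings estimates into the ordered field
    [R]. *)
Definition rnorm x : R := complex.Re `|x|.

Lemma rnormE x : `|x| = (rnorm x)%:C.
Proof. by rewrite /rnorm RRe_real // normr_real. Qed.

Lemma rnorm_ge0 x : 0 <= rnorm x.
Proof. by rewrite -lecR -rnormE; exact: normr_ge0. Qed.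

Lemma rnormD x y : rnorm (x + y) <= rnorm x + rnorm y.
Proof. by rewrite -lecR rmorphD /= -!rnormE ler_normD. Qed.

Lemma rnormN x : rnorm (- x) = rnorm x.
Proof. by rewrite /rnorm normrN. Qed.

Lemma rnormB x y : rnorm (x - y) <= rnorm x + rnorm y.
Proof. by rewrite -(rnormN y) rnormD. Qed.

Lemma rnorm0 : rnorm 0 = 0.
Proof. by rewrite /rnorm normr0. Qed.

Lemma rnorm_eq0 x : rnorm x = 0 -> x = 0.
Proof. by move=> x0; apply/eqP; rewrite -normr_eq0 rnormE x0. Qed.

Lemma rnormM x y : rnorm (x * y) <= rnorm x * rnorm y.
Proof. by rewrite -lecR rmorphM /= -!rnormE cstar_normM. Qed.

Lemma rnormZ r x : rnorm (r%:C *: x) = `|r| * rnorm x.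
Proof.
apply: (@complexI R); rewrite rmorphM /= -!rnormE normrZ; congr (_ * _).
by rewrite normc_def /= expr0n addr0 sqrtr_sqr.
Qed.

Lemma rnormZi x : rnorm ('i *: x) = rnorm x.
Proof. by rewrite /rnorm normrZ normCi mul1r. Qed.

Lemma scaleii x : 'i *: ('i *: x) = - x.
Proof. by rewrite scalerA -expr2 sqrCi scaleN1r. Qed.

Lemma rnorm_star_mul x : rnorm (star x * x) = rnorm x ^+ 2.
Proof.
by apply: (@complexI R); rewrite rmorphXn /= -!rnormE; exact: cstar_norm.
Qed.

Lemma star_mul_eq0 x : star x * x = 0 -> x = 0.
Proof.
move=> x0; apply: rnorm_eq0; apply/eqP.
by rewrite -sqrf_eq0 -rnorm_star_mul x0 rnorm0.
Qed.

(** By the C*-identity, [|y|^2 = |y* y| <= |y*| |y|]; cancel [|y|], then exchange [y] and [y*]. *)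
Lemma rnorm_star x : rnorm (star x) = rnorm x.
Proof.
suff h y : rnorm y <= rnorm (star y).
  by apply/eqP; rewrite eq_le h -{2}(starK x) h.
have := rnorm_star_mul y; have := rnormM (star y) y; have := rnorm_ge0 y.
rewrite le_eqVlt => /predU1P[<- _ _|y0]; first exact: rnorm_ge0.
by move=> + E; rewrite E expr2 ler_pM2r.
Qed.

Lemma rnorm_proj x : star x * x = x -> rnorm x <= 1.
Proof.
move=> xx; have := rnorm_star_mul x; rewrite xx => E.
have := rnorm_ge0 x; nra.
Qed.

(** Only an inequality, since [1 = 0] in the zero algebra. *)
Lemma rnorm1 : rnorm 1 <= 1.
Proof. by apply: rnorm_proj; rewrite star1 mulr1. Qed.

Lemma rnorm_sqr x : star x = x -> rnorm (x * x) = rnorm x ^+ 2.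
Proof. by move=> sx; rewrite -rnorm_star_mul sx. Qed.

Lemma sqr_eq0 x : star x = x -> x * x = 0 -> x = 0.
Proof. by move=> sx xx; apply: star_mul_eq0; rewrite sx. Qed.

Lemma scale_half x : (2^-1)%:C *: (x + x) = x.
Proof.
rewrite -{1 2}(scale1r x) -scalerDl scalerA -[RHS]scale1r; congr (_ *: _).
by rewrite fmorphV /= rmorph_nat mulVf ?pnatr_eq0.
Qed.

(** * Completeness with explicit rates *)

Lemma cauchy_rate_limit (u : nat -> A) (d : nat -> R) :
  (forall e : R, 0 < e -> exists n, d n < e) ->
  (forall n m, (n <= m)%N -> rnorm (u n - u m) <= d n) ->
  exists l, forall n, rnorm (u n - l) <= d n.
Proof.
move=> d0 du.
have R0 (e : R[i]) : 0 < e -> e = (complex.Re e)%:C by move=> /gtr0_real /RRe_real.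
have cu : cauchy (u @ \oo).
  apply: cauchy_exP => e e0; have eE := R0 e e0; move: e0.
  rewrite eE ltcR => /d0[n dn]; exists (u n).
  exists n => // m /= nm; rewrite -ball_normE /ball_ /= rnormE ltcR.
  exact: le_lt_trans (du _ _ nm) dn.
have ul : cvg (u @ \oo) by exact: cauchy_cvg.
(* The rate passes to the limit through a term of index at least [n] that is within [e] of the
   limit. *)
exists (lim (u @ \oo)) => n; apply/ler_addgt0Pr => e e0.
move/cvgrPdist_lt: ul => /(_ e%:C); rewrite ltcR => /(_ e0)[m _ /= um].
have /um : (m <= maxn n m)%N by exact: leq_maxr.
rewrite rnormE ltcR => ule.
rewrite -(subrK (u (maxn n m)) (u n)) -addrA.
apply: (le_trans (rnormD _ _)); apply: lerD; first by rewrite du ?leq_maxl.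
by rewrite -rnormN opprB ltW.
Qed.

Lemma rnorm_null (u : A) (K : R) (d : nat -> R) : 0 <= K ->
  (forall e : R, 0 < e -> exists n, d n < e) ->
  (forall n, rnorm u <= K * d n) -> u = 0.
Proof.
move=> K0 d0 ud; apply: rnorm_eq0; apply/eqP; rewrite eq_le rnorm_ge0 andbT.
apply/ler_addgt0Pr => e e0; rewrite add0r.
(* Dividing by [K + 1] covers the case [K = 0]. *)
have K1 : 0 < K + 1 by rewrite ltr_wpDl.
have [n] := d0 _ (divr_gt0 e0 K1); rewrite ltr_pdivlMr // => dn.
by apply: (le_trans (ud n)); have [dn0|dn0] := leP 0 (d n); nra.
Qed.

(** * Square roots *)

(* Visser's iteration [y <- (b + y^2) / 2], with limit [1 - sqrt (1 - b)]; the
   error is bounded by [visser_gap], which is 1 minus the iterates for [b = 1]. *)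
Fixpoint visser b n : A :=
  if n is m.+1 then (2^-1)%:C *: (b + visser b m * visser b m) else 0.

Fixpoint visser_gap n : R :=
  if n is m.+1 then visser_gap m - visser_gap m ^+ 2 / 2 else 1.

(** The map [g -> g - g^2/2] is increasing on [[0, 1]] and sends [2/(n+2)] below [2/(n+3)]. *)
Lemma visser_gap_bound n : 0 <= visser_gap n <= 2 / (n%:R + 2).
Proof.
elim: n => [|n /andP[g0 g1]] /=; first by rewrite add0r ler01 divff ?lexx ?pnatr_eq0.
have n0 : 0 <= n%:R :> R by exact: ler0n.
have n2 : 0 < n%:R + 2 :> R by lra.
have n3 : 0 < n.+1%:R + 2 :> R by rewrite -(natr1 n); lra.
have g2 : 2 / (n%:R + 2) <= 1 :> R by rewrite ler_pdivrMr //; lra.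
apply/andP; split; first by nra.
set q := 2 / (n%:R + 2) in g1 g2.
have h : visser_gap n - visser_gap n ^+ 2 / 2 <= q - q ^+ 2 / 2 by nra.
apply: (le_trans h); rewrite ler_pdivlMr // /q -(natr1 n).
rewrite -subr_ge0.
have -> : 2 - (2 / (n%:R + 2) - (2 / (n%:R + 2)) ^+ 2 / 2) * (n%:R + 1 + 2)
  = 2 / (n%:R + 2) ^+ 2 :> R by field; lra.
by rewrite divr_ge0 // exprn_ge0 // ltW.
Qed.

Lemma visser_gap_null (e : R) : 0 < e -> exists n, visser_gap n < e.
Proof.
move=> e0; exists (Num.truncn (2 / e)).+1.
have /andP[_ h] := visser_gap_bound (Num.truncn (2 / e)).+1.
apply: (le_lt_trans h); have := truncnS_gt (2 / e).
rewrite ltr_pdivrMr // => h2; rewrite ltr_pdivrMr ?ltr_wpDl //; nra.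
Qed.

Lemma visser_bound b n : rnorm b <= 1 -> rnorm (visser b n) <= 1 - visser_gap n.
Proof.
move=> b1; elim: n => [|n IH] /=; first by rewrite rnorm0 subrr.
rewrite rnormZ ger0_norm ?invr_ge0 //.
have := rnormD b (visser b n * visser b n).
have := rnormM (visser b n) (visser b n).
have := rnorm_ge0 (visser b n); nra.
Qed.

Lemma visser_comm b x n : x * b = b * x -> x * visser b n = visser b n * x.
Proof.
move=> xb; elim: n => [|n IH] /=; first by rewrite mulr0 mul0r.
by rewrite -cscalerAr -cscalerAl mulrDr mulrDl xb mulrA IH -!mulrA IH.
Qed.

Lemma visser_star b n : star b = b -> star (visser b n) = visser b n.
Proof.
move=> sb; elim: n => [|n IH] /=; first exact: star0.
by rewrite starZr starD star_mul sb IH.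
Qed.

(** Since the iterates commute, [y^2 - z^2] factors, and each factor is bounded by its scalar
    counterpart for [b = 1]. *)
Lemma visser_step b n : rnorm b <= 1 ->
  rnorm (visser b n.+1 - visser b n) <= visser_gap n - visser_gap n.+1.
Proof.
move=> b1; elim: n => [|n IH].
  rewrite /= subr0 rnormZ mulr0 addr0 ger0_norm ?invr_ge0 // expr1n mul1r.
  by lra.
set y := visser b n.+1; set z := visser b n in IH.
have -> : visser b n.+2 - y = (2^-1)%:C *: ((y - z) * (y + z)).
  rewrite [y in _ - y]/= -/z [visser b n.+2]/= -/z -/(visser b n.+1) -/y.
  rewrite -scalerBr; congr (_ *: _).
  have yz : z * y = y * z.
    by apply: visser_comm; rewrite -visser_comm.
  by rewrite mulrBl !mulrDr opprD addrACA subrr add0r yz opprD addrA addrK.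
rewrite rnormZ ger0_norm ?invr_ge0 //.
have := rnormM (y - z) (y + z); have := rnormD y z.
have := visser_bound n.+1 b1; have := visser_bound n b1; rewrite -/y -/z.
have := rnorm_ge0 (y - z); have := rnorm_ge0 (y + z).
have -> : visser_gap n.+2 = visser_gap n.+1 - visser_gap n.+1 ^+ 2 / 2 by [].
have E : visser_gap n.+1 = visser_gap n - visser_gap n ^+ 2 / 2 by [].
have /andP[g0 _] := visser_gap_bound n; have /andP[g1 _] := visser_gap_bound n.+1.
move=> h1 h2 h3 h4 h5 h6.
have h7 : rnorm (y - z) * rnorm (y + z) <=
  (visser_gap n - visser_gap n.+1) * (2 - visser_gap n - visser_gap n.+1).
  by apply: ler_pM => //; lra.
apply: (@le_trans _ _ (2^-1 * ((visser_gap n - visser_gap n.+1)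
    * (2 - visser_gap n - visser_gap n.+1)))).
  by rewrite ler_pM2l ?invr_gt0 //; lra.
(* Nothing is lost here: half the product equals [(p - p^2/2) - (q - q^2/2)], whose first bracket is
   [q]. *)
move: E; set p := visser_gap n; set q := visser_gap n.+1 => E.
rewrite le_eqVlt; apply/orP; left; apply/eqP.
by transitivity ((p - p ^+ 2 / 2) - q + q ^+ 2 / 2); [field|rewrite -E; field].
Qed.

Lemma visser_cauchy b n m : rnorm b <= 1 -> (n <= m)%N ->
  rnorm (visser b n - visser b m) <= visser_gap n.
Proof.
move=> b1 nm; suff h : rnorm (visser b n - visser b m) <= visser_gap n - visser_gap m.
  by have /andP[g0 _] := visser_gap_bound m; lra.
rewrite -(subnK nm); elim: (m - n)%N => [|k IH].
  by rewrite add0n !subrr rnorm0.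
rewrite addSn -(subrK (visser b (k + n)) (visser b n)) -addrA.
have := visser_step (k + n) b1; rewrite -rnormN opprB => h.
have := rnormD (visser b n - visser b (k + n))
  (visser b (k + n) - visser b (k + n).+1).
by lra.
Qed.

(** The limit [l] of the iteration solves [2 l = b + l^2], so [s = 1 - l] squares to [1 - b]. The
    bound on [1 - s] records that [s] is positive. *)
Lemma sqrt_one_sub b : star b = b -> rnorm b <= 1 ->
  exists s, [/\ star s = s, rnorm (1 - s) <= 1, s * s = 1 - b &
    forall x, x * b = b * x -> x * s = s * x].
Proof.
move=> sb b1.
have [l ul] := @cauchy_rate_limit (visser b) visser_gap visser_gap_null
  (fun n m => @visser_cauchy b n m b1).
have lim_null (u : A) K : 0 <= K ->
    (forall n, rnorm u <= K * rnorm (visser b n - l)) -> u = 0.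
  move=> K0 h; apply: (@rnorm_null u K visser_gap K0 visser_gap_null) => n.
  by apply: (le_trans (h n)); rewrite ler_wpM2l.
have sl : star l = l.
  apply/eqP; rewrite -subr_eq0; apply/eqP.
  apply: (@lim_null _ 2) => // n.
  rewrite -(subrK (visser b n) (star l)) -addrA -{1}(visser_star n sb) -starB.
  apply: (le_trans (rnormD _ _)); rewrite rnorm_star -(rnormN (l - _)) opprB.
  lra.
have l1 : rnorm l <= 1.
  apply/ler_addgt0Pr => e /visser_gap_null[n gn].
  rewrite -(subrK (visser b n) l); apply: (le_trans (rnormD _ _)).
  have := ul n; rewrite -rnormN opprB; have := visser_bound n b1.
  have /andP[g0 _] := visser_gap_bound n; lra.
have cl x : x * b = b * x -> x * l = l * x.
  move=> xb; apply/eqP; rewrite -subr_eq0; apply/eqP.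
  apply: (@lim_null _ (2 * rnorm x)); first by rewrite mulr_ge0 ?rnorm_ge0.
  move=> n.
  have -> : x * l - l * x = (visser b n - l) * x - x * (visser b n - l).
    rewrite mulrBr mulrBl (visser_comm n xb) opprB [RHS]addrC addrA.
    by rewrite subrK.
  apply: (le_trans (rnormB _ _)).
  have := rnormM (visser b n - l) x; have := rnormM x (visser b n - l); lra.
have ll : l + l = b + l * l.
  apply/eqP; rewrite -subr_eq0; apply/eqP.
  (* The defect splits into two terms of norm at most [visser_gap n.+1] and two of norm at most
     [visser_gap n], hence the factor 4. *)
  apply: (@rnorm_null _ 4 visser_gap) => // [|n]; first exact: visser_gap_null.
  have -> : l + l - (b + l * l) = (l - visser b n.+1) + (l - visser b n.+1)
     + ((visser b n - l) * visser b n + l * (visser b n - l)).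
    have E : visser b n.+1 + visser b n.+1 = b + visser b n * visser b n.
      by rewrite /= -scalerDr scale_half.
    rewrite [X in _ = X + _]addrACA -opprD E mulrBl mulrBr [X in _ = _ + X]addrA subrK.
    by rewrite !opprD !addrA subrK.
  set y := visser b n; set z := visser b n.+1.
  have h1 := rnormD (l - z + (l - z)) ((y - l) * y + l * (y - l)).
  have h2 := rnormD (l - z) (l - z).
  have h3 := rnormD ((y - l) * y) (l * (y - l)).
  have h4 := rnormM (y - l) y.
  have h5 := rnormM l (y - l).
  have := ul n; have := ul n.+1; rewrite -/y -/z -(rnormN (z - l)) opprB.
  have := visser_bound n b1; rewrite -/y.
  have := rnorm_ge0 (y - l); have := rnorm_ge0 y; have := rnorm_ge0 l.
  have /andP[g0 _] := visser_gap_bound n.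
  have gs : visser_gap n.+1 <= visser_gap n by rewrite /=; nra.
  move=> p1 p2 p3 p4 p5 p6.
  have q1 : rnorm (y - l) * rnorm y <= visser_gap n by nra.
  have q2 : rnorm l * rnorm (y - l) <= visser_gap n by nra.
  lra.
exists (1 - l); split.
- by rewrite starB star1 sl.
- by rewrite opprB addrC subrK.
- rewrite mulrBl !mulrBr !mul1r mulr1 opprB addrACA -opprD ll opprD addrACA.
  by rewrite subrr addr0.
- by move=> x /cl xl; rewrite mulrBr mulrBl xl mulr1 mul1r.
Qed.

(** * Positive elements *)

(* [spos a] means that [a] is self-adjoint with nonnegative spectrum; that this
   agrees with [positive_elt] is [positive_eltP]. *)
Definition spos a := star a = a /\ 
  exists2 t : R, 0 <= t & rnorm (t%:C *: (1 : A) - a) <= t.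

Lemma rnorm_scalar r : 0 <= r -> rnorm (r%:C *: (1 : A)) <= r.
Proof. by move=> r0; rewrite rnormZ ger0_norm // ler_piMr // rnorm1. Qed.

(** Allows the witness [t] of [spos] to be enlarged, in particular to be made positive before
    dividing by it. *)
Lemma spos_ge a t t' : t <= t' -> rnorm (t%:C *: (1 : A) - a) <= t ->
  rnorm (t'%:C *: (1 : A) - a) <= t'.
Proof.
move=> tt' ta; rewrite -(subrK t t') rmorphD scalerDl -addrA.
apply: (le_trans (rnormD _ _)); rewrite lerD // rnorm_scalar ?subr_ge0 //.
Qed.

Lemma sposD a b : spos a -> spos b -> spos (a + b).
Proof.
move=> [sa [t t0 ta]] [sb [u u0 ub]]; split; first by rewrite starD sa sb.
exists (t + u); first exact: addr_ge0.
rewrite rmorphD scalerDl opprD addrACA.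
by apply: (le_trans (rnormD _ _)); exact: lerD.
Qed.

Lemma sposZ r a : 0 <= r -> spos a -> spos (r%:C *: a).
Proof.
move=> r0 [sa [t t0 ta]]; split; first by rewrite starZr sa.
exists (r * t); first exact: mulr_ge0.
by rewrite rmorphM -scalerA -scalerBr rnormZ ger0_norm // ler_wpM2l.
Qed.

(** Scaling by a positive witness writes [a / t = 1 - b] with [|b| <= 1], which reduces the root to
    [sqrt_one_sub]. *)
Lemma spos_sqrt a : spos a ->
  exists m, [/\ spos m, m * m = a & forall x, x * a = a * x -> x * m = m * x].
Proof.
move=> [sa [t t0]] /(@spos_ge a t (t + 1)); rewrite lerDl => /(_ ler01).
move: (t + 1) (ltr_wpDl t0 ltr01) => {t0}t t0 ta.
pose b := 1 - (t^-1)%:C *: a.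
have tV (z : A) : t%:C *: ((t^-1)%:C *: z) = z.
  by rewrite scalerA -rmorphM divff ?gt_eqF // scale1r.
have Vt (z : A) : (t^-1)%:C *: (t%:C *: z) = z.
  by rewrite scalerA -rmorphM mulVf ?gt_eqF // scale1r.
have [s [ss s1 s2 sc]] : exists s, [/\ star s = s, rnorm (1 - s) <= 1, s * s = 1 - b &
    forall x, x * b = b * x -> x * s = s * x].
  apply: sqrt_one_sub; first by rewrite starB star1 starZr sa.
  rewrite /b -{1}(Vt 1) -scalerBr rnormZ gtr0_norm ?invr_gt0 //.
  by rewrite mulrC ler_pdivrMr // mul1r.
exists ((Num.sqrt t)%:C *: s); split.
- apply: sposZ; first exact: sqrtr_ge0.
  by split => //; exists 1 => //; rewrite scale1r.
- rewrite -cscalerAl -cscalerAr scalerA -rmorphM -expr2 sqr_sqrtr ?ltW //.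
  by rewrite s2 /b opprB addrC subrK tV.
- move=> x xa; rewrite -cscalerAl -cscalerAr sc //.
  by rewrite /b mulrBr mulrBl mulr1 mul1r -cscalerAl -cscalerAr xa.
Qed.

(** * Cartesian decomposition and unitaries *)

Lemma star_mul_cartesian a b : star a = a -> star b = b -> a * b = b * a ->
  star (a + 'i *: b) * (a + 'i *: b) = a * a + b * b.
Proof.
move=> sa sb ab; rewrite starD starZi sa sb mulrDl !mulrDr !mulNr.
rewrite -!cscalerAl -!cscalerAr scaleii opprK ab.
by rewrite addrA addrK.
Qed.

Lemma rnorm_re a b : star a = a -> star b = b -> rnorm a <= rnorm (a + 'i *: b).
Proof.
move=> sa sb; rewrite -{1}(scale_half a) rnormZ ger0_norm ?invr_ge0 //.
have -> : a + a = (a + 'i *: b) + star (a + 'i *: b).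
  by rewrite starD starZi sa sb addrACA subrr addr0.
have := rnormD (a + 'i *: b) (star (a + 'i *: b)); rewrite rnorm_star; lra.
Qed.

Lemma rnorm_im a b : star a = a -> star b = b -> rnorm b <= rnorm (a + 'i *: b).
Proof.
move=> sa sb; rewrite -{1}(scale_half b) rnormZ ger0_norm ?invr_ge0 // -rnormZi.
have -> : 'i *: (b + b) = (a + 'i *: b) - star (a + 'i *: b).
  by rewrite starD starZi sa sb opprD opprK addrACA subrr add0r scalerDr.
have := rnormB (a + 'i *: b) (star (a + 'i *: b)); rewrite rnorm_star; lra.
Qed.

(** With [s] the square root of [1 - a^2], the element [a + i s] is unitary and [a] is its real
    part. *)
Lemma unit_ball_sqrt a : star a = a -> rnorm a <= 1 ->
  exists s, [/\ star s = s, a * a + s * s = 1, rnorm s <= 1 &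
    forall x, x * a = a * x -> x * s = s * x].
Proof.
move=> sa a1.
have [s [ss s1 s2 sc]] : exists s, [/\ star s = s, rnorm (1 - s) <= 1,
    s * s = 1 - a * a & forall x, x * (a * a) = (a * a) * x -> x * s = s * x].
  apply: sqrt_one_sub; first by rewrite star_mul sa.
  by rewrite rnorm_sqr // expr_le1 // rnorm_ge0.
have cs x : x * a = a * x -> x * s = s * x.
  by move=> xa; apply: sc; rewrite mulrA xa -mulrA xa mulrA.
have as1 : a * a + s * s = 1 by rewrite s2 addrC subrK.
exists s; split => //; apply: (le_trans (rnorm_im sa ss)).
have := rnorm_star_mul (a + 'i *: s).
rewrite star_mul_cartesian ?cs // as1 => E.
have := rnorm1; rewrite E; have := rnorm_ge0 (a + 'i *: s); nra.
Qed.

(** After scaling to [|b| <= 1], [unit_ball_sqrt] gives [1 - b^2 = s^2] with [|s| <= 1], so [t = 1]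
    is a witness. *)
Lemma spos_sqr a : star a = a -> spos (a * a).
Proof.
move=> sa; pose r := rnorm a + 1.
have r0 : 0 < r by rewrite ltr_wpDl // rnorm_ge0.
pose b := (r^-1)%:C *: a.
have ab : a = r%:C *: b by rewrite scalerA -rmorphM divff ?gt_eqF // scale1r.
have sb : star b = b by rewrite starZr sa.
have b1 : rnorm b <= 1.
  rewrite rnormZ gtr0_norm ?invr_gt0 // mulrC ler_pdivrMr // mul1r.
  by rewrite /r lerDl.
rewrite ab -cscalerAl -cscalerAr; do 2 (apply: sposZ; first exact: ltW).
split; first by rewrite star_mul sb.
exists 1 => //; rewrite scale1r.
have [s [ss bs s1 _]] := unit_ball_sqrt sb b1.
rewrite -bs addrAC subrr add0r rnorm_sqr // expr_le1 // rnorm_ge0 //.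
Qed.

(** The roots [m] of [a] and [n] of [-a] commute, so [z = m + i n] satisfies [z* z = a - a = 0];
    hence [m], the real part of [z], vanishes. *)
Lemma spos_antisym a : spos a -> spos (- a) -> a = 0.
Proof.
move=> /spos_sqrt[m [[sm _] m2 mc]] /spos_sqrt[n [[sn _] n2 nc]].
have mn : m * n = n * m.
  by apply: nc; rewrite mulrN mulNr -m2 mulrA.
have := star_mul_cartesian sm sn mn.
rewrite m2 n2 subrr => /star_mul_eq0 mn0.
have := rnorm_re sm sn; rewrite mn0 rnorm0 => m0.
have {}m0 : m = 0 by apply: rnorm_eq0; apply/eqP; rewrite eq_le m0 rnorm_ge0.
by rewrite -m2 m0 mul0r.
Qed.

(** * Positivity of [star x * x] *)

Lemma star_exp x n : star (x ^+ n) = star x ^+ n.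
Proof.
by elim: n => [|n IH]; rewrite ?expr0 ?star1 // exprS exprSr star_mul IH.
Qed.

Lemma rnorm_exp_le1 x n : rnorm x <= 1 -> rnorm (x ^+ n) <= 1.
Proof.
move=> x1; elim: n => [|n IH]; first exact: rnorm1.
rewrite exprS; apply: (le_trans (rnormM _ _)).
by rewrite mulr_ile1 ?rnorm_ge0.
Qed.

Lemma rnorm_exp2n x k : star x = x -> rnorm (x ^+ (2 ^ k)) = rnorm x ^+ (2 ^ k).
Proof.
move=> sx; elim: k => [|k IH] //.
by rewrite expnSr !exprM expr2 rnorm_sqr ?IH // star_exp sx.
Qed.

(** If [q > 1], Bernoulli's inequality followed by one squaring makes [q ^+ (2 ^ k)] grow
    quadratically in [2 ^ k], beyond any linear bound. *)
Lemma le1_of_linear_growth (q K : R) : 0 <= q ->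
  (forall k, q ^+ (2 ^ k) <= 1 + (2 ^ k)%:R * K) -> q <= 1.
Proof.
move=> q0 qK; rewrite leNgt; apply/negP => q1.
have e0 : 0 < q - 1 by rewrite subr_gt0.
have bern n : 1 + n%:R * (q - 1) <= q ^+ n.
  elim: n => [|n IH]; first by rewrite mul0r addr0.
  rewrite exprS -natr1; have : 0 <= n%:R :> R by exact: ler0n.
  move=> n0; have : 0 <= (q ^+ n - (1 + n%:R * (q - 1))) * q.
    by apply: mulr_ge0; lra.
  have : 0 <= n%:R * (q - 1) ^+ 2 by rewrite mulr_ge0 ?sqr_ge0.
  by nra.
have n2 k : (k < 2 ^ k)%N by exact: ltn_expl.
(* With [N = 2^k], the contradiction arises at exponent [2 N], where this choice makes
   [(1 + N (q - 1))^2] exceed [1 + 2 N K]. *)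
pose k := Num.truncn (2 * `|K| / (q - 1) ^+ 2).
have kK : 2 * `|K| < (2 ^ k)%:R * (q - 1) ^+ 2.
  rewrite -ltr_pdivrMr ?exprn_gt0 //.
  apply: lt_le_trans (truncnS_gt _) _; rewrite ler_nat; exact: n2.
have := qK k.+1; rewrite expnSr exprM natrM.
have := bern (2 ^ k)%N; have := ler_norm K.
have : 1 <= (2 ^ k)%:R :> R by rewrite ler1n expn_gt0.
move: ((2 ^ k)%:R) (q ^+ (2 ^ k)) kK => N Q kK N1 KK hQ.
have : 0 <= N * (q - 1) by apply: mulr_ge0; lra.
move=> h hQ2.
have : (1 + N * (q - 1)) ^+ 2 <= Q ^+ 2.
  by rewrite ler_sqr // nnegrE; lra.
have : N * (2 * `|K|) <= N * (N * (q - 1) ^+ 2).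
  by rewrite ler_wpM2l //; lra.
have : N * K <= N * `|K| by rewrite ler_wpM2l //; lra.
nra.
Qed.

(* From [g x = x h], where [g] and [h] are the two elements below, the norm
   of [g ^+ n] grows at most linearly in [n]; as [g] is self-adjoint, this
   bounds its norm by 1. *)
Lemma rnorm_one_add_swap x : rnorm (1 + star x * x) <= 1 ->
  rnorm (1 + x * star x) <= 1.
Proof.
set h := 1 + star x * x; set g := 1 + x * star x => h1.
have gx n : g ^+ n * x = x * h ^+ n.
  elim: n => [|n IH]; first by rewrite !expr0 mul1r mulr1.
  rewrite exprS -mulrA IH exprS !mulrA; congr (_ * _).
  by rewrite /g /h mulrDl mulrDr mul1r mulr1 mulrA.
have sg : star g = g by rewrite starD star1 star_mul starK.
apply: (@le1_of_linear_growth _ (rnorm x ^+ 2)); first exact: rnorm_ge0.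
move=> k; rewrite -rnorm_exp2n //.
elim: (2 ^ k)%N => [|n IH]; first by rewrite mul0r addr0; exact: rnorm1.
rewrite exprSr {2}/g mulrDr mulr1 mulrA gx.
have := rnormD (g ^+ n) (x * h ^+ n * star x).
have := rnormM (x * h ^+ n) (star x); have := rnormM x (h ^+ n).
have := rnorm_exp_le1 n h1; rewrite rnorm_star -natr1.
have := rnorm_ge0 x; have := rnorm_ge0 (h ^+ n); nra.
Qed.

(** Dividing [x] by the square root of a positive witness reduces the claim to [rnorm_one_add_swap],
    where the witness is 1. *)
Lemma spos_opp_swap x : spos (- (star x * x)) -> spos (- (x * star x)).
Proof.
move=> [_ [t t0]] /(@spos_ge _ t (t + 1)); rewrite lerDl => /(_ ler01).
move: (t + 1) (ltr_wpDl t0 ltr01) => {t0}t t0; rewrite opprK => tx.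
split; first by rewrite starN star_mul starK.
exists t; [exact: ltW|rewrite opprK].
have [y xy] : exists y, x = (Num.sqrt t)%:C *: y.
  exists (((Num.sqrt t)^-1)%:C *: x).
  by rewrite scalerA -rmorphM divff ?gt_eqF ?sqrtr_gt0 // scale1r.
have tt : (Num.sqrt t)%:C * (Num.sqrt t)%:C = t%:C.
  by rewrite -rmorphM -expr2 sqr_sqrtr // ltW.
move: tx; rewrite xy starZr -!cscalerAl -!cscalerAr !scalerA tt -!scalerDr !rnormZ.
rewrite gtr0_norm // !ger_pMr //; exact: rnorm_one_add_swap.
Qed.

(** The sum [x* x + x x*] is half a sum of squares of self-adjoint elements, thus positive. Adding
    [- x x*], positive by the swap, makes [x* x] positive as well, and antisymmetry applies. *)
Lemma spos_opp_star_mul x : spos (- (star x * x)) -> x = 0.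
Proof.
move=> nx; apply: star_mul_eq0; apply: spos_antisym => //.
pose u := x + star x; pose v := 'i *: (x - star x).
have su : star u = u by rewrite starD starK addrC.
have sv : star v = v by rewrite starZi starB starK -scalerN opprB.
have uv : u * u + v * v = (x * star x + star x * x) + (x * star x + star x * x).
  rewrite -cscalerAl -cscalerAr scaleii.
  rewrite !mulrDl !mulrDr !mulNr !mulrN opprK.
  set p := x * x; set q := x * star x; set r := star x * x; set s := star x * star x.
  rewrite !opprD !opprK [LHS]addrACA [p + q]addrC [r - s]addrC.
  by rewrite [q + p + _]addrA [r + s + _]addrA !addrK addrACA.
have -> : star x * x = (2^-1)%:C *: (u * u + v * v) + (- (x * star x)).
  by rewrite uv scale_half [x * star x + _]addrC addrK.
apply: sposD; last exact: spos_opp_swap.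
by apply: sposZ; [rewrite invr_ge0|apply: sposD; apply: spos_sqr].
Qed.

(** Let [k] be the root of [h^2], the absolute value of [h]; then [n = k - h] is twice the negative
    part of [h]. With [w = v n], the element [- w* w = - n h n = n k n] is a square, so [v n = 0] by
    [spos_opp_star_mul]; this forces [n = 0] and [h = k]. *)
Lemma spos_star_mul v : spos (star v * v).
Proof.
set h := star v * v; have sh : star h = h by rewrite star_mul starK.
have [k [pk k2 kc]] := spos_sqrt (spos_sqr sh); have [sk _] := pk.
have hk : h * k = k * h by apply: kc; rewrite mulrA.
pose n := k - h.
have sn : star n = n by rewrite starB sk sh.
have hn : h * n = - (k * n).
  by rewrite /n !mulrBr k2 hk opprB.
have nk : n * k = k * n by rewrite /n mulrBl mulrBr hk.
have [m [[sm _] m2 mc]] := spos_sqrt pk.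
have nm := mc _ nk.
have vn : v * n = 0.
  apply: spos_opp_star_mul.
  have -> : - (star (v * n) * (v * n)) = (n * m) * (n * m).
    rewrite star_mul sn mulrA -[n * star v * v]mulrA -/h -mulrA hn mulrN opprK.
    by rewrite -m2 {2}nm !mulrA.
  by apply: spos_sqr; rewrite star_mul sn sm nm.
have hn0 : h * n = 0 by rewrite /h -mulrA vn mulr0.
have kn0 : k * n = 0 by apply/eqP; rewrite -oppr_eq0 -hn hn0.
have n0 : n = 0 by apply: sqr_eq0 => //; rewrite {1}/n mulrBl hn0 kn0 subrr.
by move/eqP: n0; rewrite subr_eq0 => /eqP <-.
Qed.

Lemma positive_eltP a : positive_elt a <-> spos a.
Proof.
split=> [[b ->]|/spos_sqrt[m [[sm _] m2 _]]]; first exact: spos_star_mul.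
by exists m; rewrite sm.
Qed.

Lemma star_mul_add_eq0 x y : star x * x + star y * y = 0 -> x = 0.
Proof.
move=> xy0; apply: spos_opp_star_mul.
suff -> : - (star x * x) = star y * y by exact: spos_star_mul.
by apply/eqP; rewrite eq_sym -addr_eq0 addrC xy0.
Qed.

(** * Self-adjoint elements and linear maps *)

Lemma spos_scalar t : 0 <= t -> spos (t%:C *: (1 : A)).
Proof.
move=> t0; split; first by rewrite starZr star1.
by exists t; rewrite // subrr rnorm0.
Qed.

(** Exhibits a self-adjoint [a] as the difference of the positive elements [|a| 1] and
    [|a| 1 - a]. *)
Lemma spos_rnorm_sub a : star a = a -> spos ((rnorm a)%:C *: (1 : A) - a).
Proof.
move=> sa; split; first by rewrite starB starZr star1 sa.
exists (rnorm a); first exact: rnorm_ge0.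
by rewrite opprB addrC subrK.
Qed.

Lemma cartesian x : exists a b, [/\ star a = a, star b = b & x = a + 'i *: b].
Proof.
exists ((2^-1)%:C *: (x + star x)), ((2^-1)%:C *: ('i *: (star x - x))); split.
- by rewrite starZr starD starK addrC.
- by rewrite starZr starZi starB starK -scalerN opprB.
- rewrite [X in _ = _ + X]scalerA mulrC -scalerA scaleii opprB -scalerDr.
  by rewrite addrACA subrr addr0 scale_half.
Qed.

Lemma linear_pack (f : A -> A) : linear f ->
  exists g : {linear A -> A}, g =1 f.
Proof.
move=> lf.
pose g : {linear A -> A} := HB.pack f (GRing.isLinear.Build _ _ _ _ f lf).
by exists g.
Qed.

Lemma rnorm_le_continuous (f : {linear A -> A}) K :
  (forall x, rnorm (f x) <= K * rnorm x) -> continuous f.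
Proof.
move=> fK; apply: bounded_linear_continuous; apply/linear_boundedP.
exists K%:C; split; first by rewrite complex_real.
move=> r Kr x; rewrite !rnormE.
apply: (@le_trans _ _ ((K * rnorm x)%:C)); first by rewrite lecR.
by rewrite rmorphM; apply: ler_wpM2r (ltW Kr); rewrite lecR rnorm_ge0.
Qed.

Lemma rnorm_linear_le (f : {linear A -> A}) :
  (forall x, rnorm x <= 1 -> rnorm (f x) <= 1) ->
  forall x, rnorm (f x) <= rnorm x.
Proof.
move=> f1 x; have := rnorm_ge0 x; rewrite le_eqVlt => /predU1P[/esym x0|x0].
  by rewrite (rnorm_eq0 x0) linear0.
have E : x = (rnorm x)%:C *: (((rnorm x)^-1)%:C *: x).
  by rewrite scalerA -rmorphM divff ?gt_eqF // scale1r.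
rewrite {1}E linearZ rnormZ gtr0_norm // ger_pMr //; apply: f1.
by rewrite rnormZ gtr0_norm ?invr_gt0 // mulVf ?gt_eqF.
Qed.

Lemma closed_linear_eq0 (f : {linear A -> A}) K :
  (forall x, rnorm (f x) <= K * rnorm x) -> closed [set x | f x = 0].
Proof.
move=> /rnorm_le_continuous fc.
apply: ((continuous_closedP f).1 fc [set 0]).
exact/accessible_closed_set1/hausdorff_accessible/norm_hausdorff.
Qed.

(** Positive elements have self-adjoint images, hence so do their differences, the self-adjoint
    elements; the Cartesian decomposition gives the rest. *)
Lemma positive_linear_star (L : {linear A -> A}) :
  (forall a, positive_elt a -> positive_elt (L a)) ->
  forall x, L (star x) = star (L x).
Proof.
move=> Lp.
have Ls a : spos a -> star (L a) = L a.
  by move=> /positive_eltP/Lp/positive_eltP[].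
have Lsa a : star a = a -> star (L a) = L a.
  move=> sa; have -> : a = (rnorm a)%:C *: (1 : A) - ((rnorm a)%:C *: (1 : A) - a).
    by rewrite opprB addrC subrK.
  rewrite linearB starB !Ls //; first exact: spos_rnorm_sub.
  exact/spos_scalar/rnorm_ge0.
move=> x; have [a [b [sa sb ->]]] := cartesian x.
rewrite starD starZi sa sb linearB linearD !linearZ starD starZi !Lsa //=.
by rewrite scalerN.
Qed.

End CStarTheory.

(** * Complete transfer operators *)

Section Endomorphism.
Context {R : realType} {A : unitalCStarAlgType R}.
Variables (alpha : {linear A -> A}) (alpha_endo : star_endomorphism alpha).
Implicit Types (a b c d x y : A).

Let p := alpha 1.

Let alphaM x y : alpha (x * y) = alpha x * alpha y.
Proof. exact: star_endoM alpha_endo x y. Qed.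

Let alpha_star x : alpha (star x) = star (alpha x).
Proof. exact: star_endo_star alpha_endo x. Qed.

Let alphaMp x : alpha x * p = alpha x.
Proof. by rewrite -alphaM mulr1. Qed.

Let palphaM x : p * alpha x = alpha x.
Proof. by rewrite -alphaM mul1r. Qed.

Let pp : p * p = p. Proof. exact: alphaMp. Qed.

Let star_p : star p = p. Proof. by rewrite -alpha_star star1. Qed.

Let rnorm_p : rnorm p <= 1.
Proof. by apply: rnorm_proj; rewrite star_p pp. Qed.

Let rnorm_corner x : rnorm (p * x * p) <= rnorm x.
Proof.
have := rnormM (p * x) p; have := rnormM p x; have := rnorm_ge0 (p * x).
by have := rnorm_ge0 x; have := rnorm_ge0 p; have := rnorm_p; nra.
Qed.

(** * Necessity of both conditions *)

Lemma closed_corner : closed [set x : A | p * x * p = x].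
Proof.
have lf : linear (fun x => p * x * p - x).
  move=> c x y; rewrite mulrDr mulrDl -cscalerAr -cscalerAl opprD addrACA.
  by rewrite -scalerBr.
have [f fE] := linear_pack lf.
suff -> : [set x : A | p * x * p = x] = [set x | f x = 0].
  apply: (@closed_linear_eq0 _ _ f 2) => x; rewrite fE.
  by have := rnormB (p * x * p) x; have := rnorm_corner x; lra.
apply/seteqP; split=> x /=; rewrite fE; first by move=> ->; rewrite subrr.
by move/eqP; rewrite subr_eq0 => /eqP.
Qed.

Lemma range_hereditary : (forall x, range alpha x <-> p * x * p = x) ->
  hereditary_subalgebra (range alpha).
Proof.
move=> rangeE; split; first split.
- by exists 0; rewrite ?linear0.
- by move=> _ _ [x _ <-] [y _ <-]; exists (x + y); rewrite ?linearD.
- by move=> c _ [x _ <-]; exists (c *: x); rewrite ?linearZ.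
- by move=> _ _ [x _ <-] [y _ <-]; exists (x * y).
- by move=> _ [x _ <-]; exists (star x).
- suff -> : range alpha = [set x | p * x * p = x] by exact: closed_corner.
  by apply/seteqP; split=> x /= /rangeE.
move=> a b [x ax] _ /rangeE pb [y bay]; apply/rangeE.
have bp : b * (1 - p) = 0 by rewrite -pb mulrBr mulr1 -[_ * p * p]mulrA pp subrr.
(* Compressing [a + (b - a) = b] by [1 - p] gives zero on the right and a sum of two positive terms
   on the left. *)
have xp : x * (1 - p) = 0.
  apply: (@star_mul_add_eq0 _ _ _ (y * (1 - p))).
  rewrite !star_mul !mulrA -[_ * _ * x]mulrA -[_ * _ * y]mulrA -ax -bay.
  by rewrite -mulrDl -mulrDr [a + _]addrC subrK -mulrA bp mulr0.
have ap : a * p = a.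
  apply/eqP; rewrite eq_sym -subr_eq0 -{1}(mulr1 a) -mulrBr ax -mulrA xp.
  by rewrite mulr0.
have sa : star a = a by rewrite ax star_mul starK.
by rewrite -mulrA ap -sa -{1}star_p -star_mul ap.
Qed.

Lemma complete_transfer_kernel_unital (L : {linear A -> A}) :
  complete_transfer_operator alpha L -> has_mul_unit (ker_endo alpha).
Proof.
move=> [[_ Lpos Ltr] Lcomp].
have Lstar := positive_linear_star Lpos.
(* Taking adjoints moves the transfer identity to the right; the two versions together make [L 1]
   central. *)
have Ltr_r a b : L (b * alpha a) = L b * a.
  rewrite -(starK (b * alpha a)) star_mul -alpha_star Lstar Ltr star_mul.
  by rewrite -Lstar !starK.
have L1C a : L 1 * a = a * L 1 by rewrite -Ltr_r mul1r -Ltr mulr1.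
exists (1 - L 1).
  by rewrite /ker_endo /= linearB /= Lcomp -/p mulr1 pp subrr.
move=> a /= a0; rewrite /ker_endo /= in a0.
have aL : a * L 1 = 0 by rewrite -Ltr a0 mul0r linear0.
by rewrite mulrBl mulrBr L1C aL mul1r mulr1 subr0.
Qed.

Lemma complete_transfer_range_hereditary (L : {linear A -> A}) :
  complete_transfer_operator alpha L -> hereditary_subalgebra (range alpha).
Proof.
move=> [_ Lcomp]; apply: range_hereditary => x; split=> [[y _ <-]|px].
  by rewrite palphaM alphaMp.
by exists (L x); rewrite ?Lcomp.
Qed.

(** * Sufficiency: construction of the operator *)

(** For positive [a], [p a p <= |a| p] and [|a| p] is the image of a scalar, so heredity puts
    [p a p] in the range; linearity extends this to all [x]. *)
Lemma hereditary_corner : hereditary_subalgebra (range alpha) ->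
  forall x, exists c, alpha c = p * x * p.
Proof.
move=> [_ her].
have pos_corner a : spos a -> exists c, alpha c = p * a * p.
  move=> pa; have [sa _] := pa.
  have corner b : positive_elt b -> positive_elt (p * b * p).
    by move=> [z ->]; exists (z * p); rewrite star_mul star_p !mulrA.
  suff [c _ cE] : range alpha (p * a * p) by exists c.
  apply: (her _ ((rnorm a)%:C *: p)).
  - exact/corner/positive_eltP.
  - apply/positive_eltP/sposZ; first exact: rnorm_ge0.
    by apply/positive_eltP; exists p; rewrite star_p pp.
  - by exists ((rnorm a)%:C *: (1 : A)); rewrite ?linearZ.
  - rewrite /elt_le; have := corner _ ((positive_eltP _).2 (spos_rnorm_sub sa)).
    by rewrite mulrBr mulrBl -cscalerAr -cscalerAl mulr1 pp.
have sa_corner a : star a = a -> exists c, alpha c = p * a * p.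
  move=> sa; have [c cE] := pos_corner _ (spos_scalar (rnorm_ge0 a)).
  have [d dE] := pos_corner _ (spos_rnorm_sub sa).
  exists (c - d); rewrite linearB /= cE dE -mulrBl -mulrBr.
  by rewrite opprB [_ + (a - _)]addrC subrK.
move=> x; have [a [b [sa sb ->]]] := cartesian x.
have [c cE] := sa_corner _ sa; have [d dE] := sa_corner _ sb.
exists (c + 'i *: d); rewrite linearD linearZ /= cE dE.
by rewrite mulrDr mulrDl -cscalerAr -cscalerAl.
Qed.

Lemma complete_transfer_exists : has_mul_unit (ker_endo alpha) ->
  hereditary_subalgebra (range alpha) ->
  exists L : {linear A -> A}, complete_transfer_operator alpha L.
Proof.
(* Each [g x] is an arbitrary preimage of [p x p], so [g] need not be linear; multiplying by [1 - e]
   removes the ambiguity. *)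
move=> [e e0 eU] /hereditary_corner/choice[g gE].
rewrite /ker_endo /= in e0 eU.
(* The kernel is a two-sided ideal, so [e x] and [x e] both equal [e x e]. *)
have eC x : e * x = x * e.
  have /eU[_ <-] : alpha (e * x) = 0 by rewrite alphaM e0 mul0r.
  have /eU[<- _] : alpha (x * e) = 0 by rewrite alphaM e0 mulr0.
  by rewrite mulrA.
have se : star e = e.
  have /eU[es _] : alpha (star e) = 0 by rewrite alpha_star e0 star0.
  by rewrite -[RHS]starK -[in RHS]es star_mul starK es.
pose f := 1 - e.
have fC x : f * x = x * f by rewrite mulrBl mulrBr mul1r mulr1 eC.
have ff : f * f = f.
  by rewrite {2}/f mulrBr mulr1 mulrBl mul1r (eU e e0).1 subrr subr0.
have sf : star f = f by rewrite starB star1 se.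
have rnorm_f : rnorm f <= 1 by apply: rnorm_proj; rewrite sf ff.
have alphaf x : alpha (f * x) = alpha x.
  by rewrite mulrBl mul1r linearB /= alphaM e0 mul0r subr0.
(* As [f] kills the kernel, identities between multiples of [f] may be checked after applying
   [alpha]. *)
have fI c d : alpha c = alpha d -> f * c = f * d.
  move=> cd; apply/eqP; rewrite -subr_eq0 -mulrBr /f mulrBl mul1r.
  by rewrite (eU (c - d) _).1 ?subrr // linearB /= cd subrr.
have lL : linear (fun x => f * g x).
  move=> c x y; rewrite cscalerAr -mulrDr; apply: fI.
  rewrite linearD linearZ /= !gE mulrDr mulrDl.
  by rewrite -cscalerAr -cscalerAl.
have [L LE] := linear_pack lL.
have LfE x d : alpha d = p * x * p -> L x = f * d.
  by move=> dE; rewrite LE; apply: fI; rewrite gE dE.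
have fmul c d : (f * c) * (f * d) = f * (c * d).
  by rewrite -mulrA (mulrA c f d) -(fC c) !mulrA ff.
have starf c : star (f * c) = f * star c by rewrite star_mul sf fC.
(* The element [f c] is the real part of some [w] with [w* w = f], a lift of the compression
   [p (a + i s)] of a unitary; then [|f d|^2 = |f c| <= 1]. *)
have L_unit_ball x : rnorm x <= 1 -> rnorm (L x) <= 1.
  move=> x1; pose y := p * x * p; pose d := g x; pose c := star d * d.
  pose a := star y * y.
  have dE : alpha d = y by rewrite gE.
  have cE : alpha c = a by rewrite alphaM alpha_star dE.
  have sc : star c = c by rewrite star_mul starK.
  have sa : star a = a by rewrite star_mul starK.
  have pa : p * a = a by rewrite -cE palphaM.
  have ap : a * p = a by rewrite -cE alphaMp.
  have a1 : rnorm a <= 1.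
    rewrite rnorm_star_mul expr_le1 ?rnorm_ge0 //.
    exact: le_trans (rnorm_corner x) x1.
  have [s [ss as1 _ sC]] := unit_ball_sqrt sa a1.
  have ps : p * s = s * p by apply: sC; rewrite pa ap.
  have as_ : a * s = s * a by apply: sC.
  (* Averaging with the adjoint yields a self-adjoint lift of [p s], which the chosen [g s] need not
     be. *)
  pose k := (2^-1)%:C *: (g s + star (g s)).
  have sk : star k = k by rewrite starZr starD starK addrC.
  have kE : alpha k = p * s.
    rewrite linearZ linearD /= alpha_star gE !star_mul ss star_p mulrA.
    by rewrite scale_half -mulrA -ps mulrA pp.
  have ck : (f * c) * (f * k) = (f * k) * (f * c).
    rewrite !fmul; apply: fI; rewrite (alphaM c k) (alphaM k c) cE kE mulrA ap.
    by rewrite -[in RHS]mulrA -as_ mulrA pa.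
  have w1 : star (f * c + 'i *: (f * k)) * (f * c + 'i *: (f * k)) = f.
    rewrite star_mul_cartesian ?starf ?sc ?sk // !fmul -mulrDr -[RHS]mulr1.
    apply: fI; rewrite linearD /= (alphaM c c) (alphaM k k) cE kE -/p.
    have -> : a * a = a * a * p by rewrite -[RHS]mulrA ap.
    have -> : p * s * (p * s) = s * s * p.
      by rewrite ps -[LHS]mulrA (mulrA p s p) ps -[s * p * p]mulrA pp mulrA.
    by rewrite -mulrDl as1 mul1r.
  have fc1 : rnorm (f * c) <= 1.
    apply: (@le_trans _ _ (rnorm (f * c + 'i *: (f * k)))).
      by apply: rnorm_re; rewrite starf ?sc ?sk.
    have := rnorm_star_mul (f * c + 'i *: (f * k)); rewrite w1 => w2.
    by have := rnorm_ge0 (f * c + 'i *: (f * k)); nra.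
  have := rnorm_star_mul (f * d); rewrite starf fmul -/c => dd.
  by rewrite LE -/d; have := rnorm_ge0 (f * d); nra.
exists L; split; first split.
- apply: (@rnorm_le_continuous _ _ L 1) => x; rewrite mul1r.
  exact: rnorm_linear_le.
- move=> u [z uz].
  have pu : spos (p * u * p).
    have -> : p * u * p = star (z * p) * (z * p).
      by rewrite uz star_mul star_p !mulrA.
    exact: spos_star_mul.
  have [m [[sm _] m2 mC]] := spos_sqrt pu.
  have pm : p * m = m * p by apply: mC; rewrite !mulrA pp -[RHS]mulrA pp.
  (* With [m] the root of [p u p], the image under [alpha] of [star (g m) * g m] is
     [p m^2 p = p u p]. *)
  exists (f * g m); rewrite starf fmul; apply: LfE.
  have pmp : p * m * p = m * p by rewrite pm -mulrA pp.
  rewrite alphaM alpha_star gE pmp star_mul sm star_p mulrA -[p * m * m]mulrA.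
  by rewrite m2 !mulrA pp -[LHS]mulrA pp.
- move=> a b; rewrite (LfE _ (a * g b)).
    by rewrite LE !mulrA fC.
  by rewrite alphaM gE !mulrA palphaM alphaMp.
- by move=> a; rewrite LE alphaf gE.
Qed.

End Endomorphism.

Theorem mainTheorem2 (R : realType) (A : unitalCStarAlgType R)
    (alpha : {linear A -> A}) (alpha_endo : star_endomorphism alpha) :
  (exists L : {linear A -> A}, complete_transfer_operator alpha L) <->
  (has_mul_unit (ker_endo alpha) /\ hereditary_subalgebra (range alpha)).
Proof.
split=> [[L LC]|[kerU her]]; last exact: complete_transfer_exists.
split; first exact: complete_transfer_kernel_unital LC.
exact: complete_transfer_range_hereditary LC.
Qed.
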